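(* Let $A$ be a unital ring, let $S$ be a cancellative left Ore monoid with enveloping group $G=S^{-1}S$, and let $\alpha: S\rightarrow \mathrm{Endr}(A)$ be an action of $S$ on $A$. Let $I:=\bigcup_{s'\in S}\ker(\alpha_{s'})$. Then $\alpha$ extends to an action $\widehat{\alpha}: G\rightarrow \mathrm{Aut}\big(S^{-1}(S_-(A/I)S_+)\big)$, and there exists a nonzero idempotent $e\in S^{-1}(S_-(A/I)S_+)$ such that $\widehat{\alpha}_s(e)\le e$ for all $s\in S$ and $$S^{\mathrm{op}}*_\alpha A*_\alpha S\;\cong\; e\big((S^{-1}(S_-(A/I)S_+))*_{\widehat{\alpha}}G\big)e$$ as $G$-graded rings.
   Context: Actions: for a unital ring $A$, $\mathrm{Endr}(A)$ is the monoid of not necessarily unital ring endomorphisms of $A$; an action of a monoid $S$ on $A$ is a monoid homomorphism $\alpha: S\to \mathrm{Endr}(A)$, $s\mapsto\alpha_s$. Put $p_s=\alpha_s(1)$, an idempotent. A monoid $S$ is left Ore if for all $s,t\in S$ there are $\hat s,\hat t\in S$ with $\hat s t=\hat t s$. It is left reversible if $ts=us$ in $S$ implies $s't=s'u$ for some $s'\in S$. A cancellative left Ore monoid is left reversible and embeds in its group of left fractions (enveloping group) $G=S^{-1}S$. Fractional skew monoid ring: for a left Ore, left reversible monoid $S$ acting on $A$, $S^{\mathrm{op}}*_\alpha A*_\alpha S$ is the unital ring $R$ with a unital ring homomorphism $\phi: A\to R$ and monoid homomorphisms $S^{\mathrm{op}}\to R$, $s\mapsto s_-$, and $S\to R$,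 $s\mapsto s_+$, universal with respect to: (1) $s_+\phi(a)=\phi(\alpha_s(a))s_+$; (2) $\phi(a)s_-=s_-\phi(\alpha_s(a))$; (3) $s_-s_+=1$; (4) $s_+s_-=\phi(p_s)$, for all $a\in A$, $s\in S$. It is $S^{-1}S$-graded by $R=\bigoplus_{x\in S^{-1}S}R_x$, $R_x=\bigcup_{s^{-1}t=x}s_-\phi(A)t_+$. $I$ is a two-sided ideal of $A$ and $\alpha$ induces an action $\alpha'$ of $S$ on $A/I$ by injective endomorphisms. When an action on a ring is by injective endomorphisms, $\phi$ is injective and the ring is identified with its image under $\phi$. $S_-(A/I)S_+$ denotes the subset $\{s_-as_+ : s\in S, a\in A/I\}$ of $S^{\mathrm{op}}*_{\alpha'}(A/I)*_{\alpha'}S$; it is a unital subring containing $A/I$, and $S$ acts on it by the injective endomorphisms $\overline{\alpha}_t(x)=t_+xt_-$. The ring $S^{-1}B$: for a ring $B$ with an action $\beta$ of $S$ by injective endomorphisms, $S^{-1}B=(S\times B)/\sim$, where $(s_1,b_1)\sim(s_2,b_2)$ iff there are $t_1,t_2\in S$ with $t_1s_1=t_2s_2$ and $\beta_{t_1}(b_1)=\beta_{t_2}(b_2)$; $[s,b]$ is the class of $(s,b)$. For $t_1s_1=t_2s_2$, $[s_1,b_1]+[s_2,b_2]=[t_1s_1,\beta_{t_1}(b_1)+\beta_{t_2}(b_2)]$ and $[s_1,b_1][s_2,b_2]=[t_1s_1,\beta_{t_1}(b_1)\beta_{t_2}(b_2)]$. $S^{-1}B$ is a not necessarily unital ring. Here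 $B=S_-(A/I)S_+$, $\beta=\overline{\alpha}$. ''$\alpha$ extends to $\widehat\alpha$'' means $\widehat{\alpha}_s([1,a+I])=[1,\alpha_s(a)+I]$ for all $s\in S$, $a\in A$. For idempotents $e,f$, $e\le f$ means $e=ef=fe$. For a group $G$ acting on a ring $C$ by automorphisms $\widehat\alpha$, $C*_{\widehat\alpha}G=\bigoplus_{g\in G}Cg$ is the skew group ring with $(cg)(dh)=c\,\widehat\alpha_g(d)\,gh$, $G$-graded with $g$-component $Cg$; the corner $e(C*_{\widehat\alpha}G)e$ has the induced grading.
   Formalization: The idempotent e is claimed to be nonzero only when 1 is not in I (A/I is nonzero); if some α_s = 0, then A/I = 0 and S^{-1}(S_-(A/I)S_+) = 0 has no nonzero idempotent. All other conclusions hold without this condition. *)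

(* Defs.v *)
From HB Require Import structures.
From mathcomp Require Import all_boot ssralg generic_quotient ring_quotient.
From mathcomp Require Import finmap boolp monalg.

Set Implicit Arguments.
Unset Strict Implicit.
Unset Printing Implicit Defensive.

Import GRing.Theory.
Local Open Scope ring_scope.
Local Open Scope quotient_scope.

Definition left_ore (S : monoidType) : Prop :=
  forall s t : S, exists s' t' : S, (s' * t = t' * s)%g.

Definition cancellative (S : monoidType) : Prop :=
  (forall s t u : S, (s * t = s * u)%g -> t = u) /\
  (forall s t u : S, (t * s = u * s)%g -> t = u).

HB.mixin Record isCancelLeftOre S of Monoid S := {
  cancellativeP : @cancellative S;
  left_oreP : @left_ore S
}.

#[short(type="cancelLeftOreType")]
HB.structure Definition CancelLeftOre :=
  { S of isCancelLeftOre S & Monoid S }.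

(* [iota : S -> G] exhibits [G] as the enveloping group [S^-1 S]. *)
Record left_fraction_group (S : monoidType) (G : groupType) (iota : S -> G)
    : Prop := LeftFractionGroup {
  lfg1 : iota 1%g = 1%g;
  lfgM : forall s t, iota (s * t)%g = (iota s * iota t)%g;
  lfg_inj : injective iota;
  lfg_frac : forall g, exists s t, g = ((iota s)^-1 * iota t)%g
}.

Record endr_action (S : monoidType) (A : pzRingType) := EndrAction {
  endr_act :> S -> A -> A;
  endr_actD : forall s, {morph endr_act s : x y / x + y};
  endr_actM : forall s, {morph endr_act s : x y / x * y};
  endr_act1 : forall x, endr_act 1%g x = x;
  endr_act_mul : forall s t x, endr_act (s * t)%g x = endr_act s (endr_act t x)
}.

Section EndrActionTheory.
Variables (S : monoidType) (A : pzRingType) (al : endr_action S A).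

Lemma endr_act0 s : al s 0 = 0.
Proof. by apply: (addrI (al s 0)); rewrite -endr_actD !addr0. Qed.

Lemma endr_actN s : {morph al s : x / - x}.
Proof.
by move=> x; apply: (addrI (al s x)); rewrite -endr_actD !subrr endr_act0.
Qed.

Lemma endr_actB s : {morph al s : x y / x - y}.
Proof. by move=> x y; rewrite endr_actD endr_actN. Qed.

End EndrActionTheory.

Record skew_relations (S : monoidType) (A : pzRingType) (al : endr_action S A)
    (R : pzRingType) (phi : {rmorphism A -> R}) (m p : S -> R)
    : Prop := SkewRelations {
  skew_m1 : m 1%g = 1;
  skew_mM : forall s t, m (s * t)%g = m t * m s;
  skew_p1 : p 1%g = 1;
  skew_pM : forall s t, p (s * t)%g = p s * p t;
  skew_pA : forall s a, p s * phi a = phi (al s a) * p s;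
  skew_Am : forall s a, phi a * m s = m s * phi (al s a);
  skew_mp : forall s, m s * p s = 1;
  skew_pm : forall s, p s * m s = phi (al s 1)
}.

Record fracSkewMonoidRing (S : monoidType) (A : pzRingType)
    (al : endr_action S A) := FracSkewMonoidRing {
  fsmr_ring :> pzRingType;
  fsmr_phi : {rmorphism A -> fsmr_ring};
  fsmr_m : S -> fsmr_ring;
  fsmr_p : S -> fsmr_ring;
  fsmr_rel : skew_relations al fsmr_phi fsmr_m fsmr_p;
  fsmr_univ : forall (T : pzRingType) (psi : {rmorphism A -> T}) (m p : S -> T),
    skew_relations al psi m p ->
    exists f : {rmorphism fsmr_ring -> T},
      [/\ f \o fsmr_phi =1 psi, f \o fsmr_m =1 m, f \o fsmr_p =1 p &
        forall g : {rmorphism fsmr_ring -> T},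
          g \o fsmr_phi =1 psi -> g \o fsmr_m =1 m -> g \o fsmr_p =1 p ->
          g =1 f]
}.

Definition fsmr_component (S : monoidType) (A : pzRingType)
    (al : endr_action S A) (R : fracSkewMonoidRing al)
    (G : groupType) (iota : S -> G) (x : G) (r : R) : Prop :=
  exists s t a, ((iota s)^-1 * iota t)%g = x /\
    r = fsmr_m R s * fsmr_phi R a * fsmr_p R t.

Module FracSkewMonoidRingExists.
Section Construction.
Variables (S : monoidType) (A : pzRingType) (al : endr_action S A).

Inductive term : Type :=
| TA of A | Tm of S | Tp of S
| TAdd of term & term | TOpp of term | TMul of term & term.

HB.instance Definition _ := gen_eqMixin term.
HB.instance Definition _ := gen_choiceMixin term.

Inductive teq : term -> term -> Prop :=
| teq_refl x : teq x x
| teq_sym x y : teq x y -> teq y x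
| teq_trans x y z : teq x y -> teq y z -> teq x z
| teq_add x x' y y' : teq x x' -> teq y y' -> teq (TAdd x y) (TAdd x' y')
| teq_opp x x' : teq x x' -> teq (TOpp x) (TOpp x')
| teq_mul x x' y y' : teq x x' -> teq y y' -> teq (TMul x y) (TMul x' y')
| teq_addA x y z : teq (TAdd x (TAdd y z)) (TAdd (TAdd x y) z)
| teq_addC x y : teq (TAdd x y) (TAdd y x)
| teq_add0 x : teq (TAdd (TA 0) x) x
| teq_addN x : teq (TAdd (TOpp x) x) (TA 0)
| teq_mulA x y z : teq (TMul x (TMul y z)) (TMul (TMul x y) z)
| teq_1mul x : teq (TMul (TA 1) x) x
| teq_mul1 x : teq (TMul x (TA 1)) x
| teq_mulDl x y z : teq (TMul (TAdd x y) z) (TAdd (TMul x z) (TMul y z))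
| teq_mulDr x y z : teq (TMul x (TAdd y z)) (TAdd (TMul x y) (TMul x z))
| teq_AD a b : teq (TA (a + b)) (TAdd (TA a) (TA b))
| teq_AM a b : teq (TA (a * b)) (TMul (TA a) (TA b))
| teq_m1 : teq (Tm 1%g) (TA 1)
| teq_mM s t : teq (Tm (s * t)%g) (TMul (Tm t) (Tm s))
| teq_p1 : teq (Tp 1%g) (TA 1)
| teq_pM s t : teq (Tp (s * t)%g) (TMul (Tp s) (Tp t))
| teq_pA s a : teq (TMul (Tp s) (TA a)) (TMul (TA (al s a)) (Tp s))
| teq_Am s a : teq (TMul (TA a) (Tm s)) (TMul (Tm s) (TA (al s a)))
| teq_mp s : teq (TMul (Tm s) (Tp s)) (TA 1)
| teq_pm s : teq (TMul (Tp s) (Tm s)) (TA (al s 1)).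

Definition teqb (x y : term) : bool := `[< teq x y >].

Lemma teqb_equiv : equiv_class_of teqb.
Proof.
split=> [x|x y|y x z]; first by apply/asboolP/teq_refl.
- by apply/asboolP/asboolP=> /teq_sym.
by move=> /asboolP xy /asboolP yz; apply/asboolP/(teq_trans xy).
Qed.

Canonical teqb_equivrel := EquivRelPack teqb_equiv.

Definition ring := {eq_quot teqb}.
HB.instance Definition _ := Choice.on ring.
HB.instance Definition _ := EqQuotient.on ring.

Lemma piE x y : teq x y -> \pi_ring x = \pi_ring y.
Proof. by move=> xy; apply/eqquotP/asboolP. Qed.

Lemma teq_repr x : teq (repr (\pi_ring x)) x.
Proof. by apply/asboolP; apply/(eqquotP ring); rewrite reprK. Qed.

Definition add : ring -> ring -> ring := locked (fun x y => \pi_ring (TAdd (repr x) (repr y))).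
Definition opp : ring -> ring := locked (fun x => \pi_ring (TOpp (repr x))).
Definition mul : ring -> ring -> ring := locked (fun x y => \pi_ring (TMul (repr x) (repr y))).

Lemma pi_add x y : \pi_ring (TAdd x y) = add (\pi_ring x) (\pi_ring y).
Proof. by rewrite /add -lock; apply/piE/teq_sym/teq_add; apply: teq_repr. Qed.
Lemma pi_opp x : \pi_ring (TOpp x) = opp (\pi_ring x).
Proof. by rewrite /opp -lock; apply/piE/teq_sym/teq_opp; apply: teq_repr. Qed.
Lemma pi_mul x y : \pi_ring (TMul x y) = mul (\pi_ring x) (\pi_ring y).
Proof. by rewrite /mul -lock; apply/piE/teq_sym/teq_mul; apply: teq_repr. Qed.

Fact ring_addA : associative add.
Proof.
elim/quotW=> x; elim/quotW=> y; elim/quotW=> z.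
by rewrite -!pi_add; apply/piE/teq_addA.
Qed.
Fact ring_addC : commutative add.
Proof.
by elim/quotW=> x; elim/quotW=> y; rewrite -!pi_add; apply/piE/teq_addC.
Qed.
Fact ring_add0 : left_id (\pi_ring (TA 0)) add.
Proof. by elim/quotW=> x; rewrite -!pi_add; apply/piE/teq_add0. Qed.
Fact ring_addN : left_inverse (\pi_ring (TA 0)) opp add.
Proof. by elim/quotW=> x; rewrite -!pi_opp -!pi_add; apply/piE/teq_addN. Qed.
Fact ring_mulA : associative mul.
Proof.
elim/quotW=> x; elim/quotW=> y; elim/quotW=> z.
by rewrite -!pi_mul; apply/piE/teq_mulA.
Qed.
Fact ring_mul1 : left_id (\pi_ring (TA 1)) mul.
Proof. by elim/quotW=> x; rewrite -!pi_mul; apply/piE/teq_1mul. Qed.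
Fact ring_mulr1 : right_id (\pi_ring (TA 1)) mul.
Proof. by elim/quotW=> x; rewrite -!pi_mul; apply/piE/teq_mul1. Qed.
Fact ring_mulDl : left_distributive mul add.
Proof.
elim/quotW=> x; elim/quotW=> y; elim/quotW=> z.
by rewrite -!(pi_mul, pi_add); apply/piE/teq_mulDl.
Qed.
Fact ring_mulDr : right_distributive mul add.
Proof.
elim/quotW=> x; elim/quotW=> y; elim/quotW=> z.
by rewrite -!(pi_mul, pi_add); apply/piE/teq_mulDr.
Qed.

HB.instance Definition _ := GRing.isZmodule.Build ring
  ring_addA ring_addC ring_add0 ring_addN.
HB.instance Definition _ := GRing.Zmodule_isPzRing.Build ring
  ring_mulA ring_mul1 ring_mulr1 ring_mulDl ring_mulDr.

Definition phi (a : A) : ring := \pi_ring (TA a).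
Definition gm (s : S) : ring := \pi_ring (Tm s).
Definition gp (s : S) : ring := \pi_ring (Tp s).

Fact phiD a b : phi (a + b) = phi a + phi b.
Proof. by rewrite /phi (piE (teq_AD a b)) pi_add. Qed.

Fact phi_zmod : zmod_morphism phi.
Proof. by move=> a b; apply/(addIr (phi b)); rewrite -phiD !subrK. Qed.

Fact phi_monoid : monoid_morphism phi.
Proof. by split=> // a b; rewrite /phi (piE (teq_AM a b)) pi_mul. Qed.

HB.instance Definition _ := GRing.isZmodMorphism.Build A ring phi phi_zmod.
HB.instance Definition _ := GRing.isMonoidMorphism.Build A ring phi phi_monoid.

Fact relations : skew_relations al phi gm gp.
Proof.
split=> *; rewrite -?[_ * _]/(mul _ _) -?pi_mul; apply: piE.
- exact: teq_m1.
- exact: teq_mM.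
- exact: teq_p1.
- exact: teq_pM.
- exact: teq_pA.
- exact: teq_Am.
- exact: teq_mp.
- exact: teq_pm.
Qed.

Section Eval.
Variables (T : pzRingType) (psi : {rmorphism A -> T}) (m p : S -> T).
Hypothesis rel : skew_relations al psi m p.

Fixpoint eval (x : term) : T :=
  match x with
  | TA a => psi a | Tm s => m s | Tp s => p s
  | TAdd x y => eval x + eval y | TOpp x => - eval x
  | TMul x y => eval x * eval y
  end.

Lemma eval_teq x y : teq x y -> eval x = eval y.
Proof.
case: rel => m1 mM p1 pM pA Am mp pm.
elim=> {x y} //=; try by move=> *; congruence.
- by move=> *; rewrite addrA.
- by move=> *; rewrite addrC.
- by move=> *; rewrite rmorph0 add0r.
- by move=> *; rewrite addNr rmorph0.
- by move=> *; rewrite mulrA.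
- by move=> *; rewrite rmorph1 mul1r.
- by move=> *; rewrite rmorph1 mulr1.
- by move=> *; rewrite mulrDl.
- by move=> *; rewrite mulrDr.
- by move=> *; rewrite rmorphD.
- by move=> *; rewrite rmorphM.
- by rewrite rmorph1.
- by rewrite rmorph1.
- by move=> *; rewrite rmorph1.
Qed.

Definition lift (x : ring) : T := eval (repr x).

Lemma lift_pi x : lift (\pi_ring x) = eval x.
Proof. exact/eval_teq/teq_repr. Qed.

Fact lift_zmod : zmod_morphism lift.
Proof.
elim/quotW=> x; elim/quotW=> y.
by rewrite -[_ - _]/(add _ (opp _)) -pi_opp -pi_add !lift_pi.
Qed.

Fact lift_monoid : monoid_morphism lift.
Proof.
split; first by rewrite -[1]/(\pi_ring (TA 1)) lift_pi /= rmorph1.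
by elim/quotW=> x; elim/quotW=> y; rewrite -[_ * _]/(mul _ _) -pi_mul !lift_pi.
Qed.

End Eval.

Fact universal (T : pzRingType) (psi : {rmorphism A -> T}) (m p : S -> T) :
  skew_relations al psi m p ->
  exists f : {rmorphism ring -> T},
    [/\ f \o phi =1 psi, f \o gm =1 m, f \o gp =1 p &
      forall g : {rmorphism ring -> T},
        g \o phi =1 psi -> g \o gm =1 m -> g \o gp =1 p -> g =1 f].
Proof.
move=> rel; pose f := lift psi m p.
pose fZ := GRing.isZmodMorphism.Build ring T f (lift_zmod rel).
pose fM := GRing.isMonoidMorphism.Build ring T f (lift_monoid rel).
pose F : {rmorphism ring -> T} := HB.pack f fZ fM.
exists F; split=> [a|s|s|g gphi gm_ gp_]; try exact: (lift_pi rel).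
elim/quotW=> x; rewrite [RHS](lift_pi rel).
elim: x => [a|s|s|x IHx y IHy|x IHx|x IHx y IHy] /=.
- exact: gphi.
- exact: gm_.
- exact: gp_.
- by rewrite pi_add rmorphD IHx IHy.
- by rewrite pi_opp rmorphN IHx.
- by rewrite pi_mul rmorphM IHx IHy.
Qed.

Definition fsmr : fracSkewMonoidRing al :=
  @FracSkewMonoidRing S A al ring phi gm gp relations universal.

End Construction.
End FracSkewMonoidRingExists.

Section QuotientByKernels.
Variables (S : cancelLeftOreType) (A : pzRingType) (al : endr_action S A).

(* [1 \in ker_union], i.e. [A/I = 0], is not excluded: the action may contain
   the zero endomorphism. *)
Definition ker_union : pred A := fun a => `[< exists s : S, al s a = 0 >].

Lemma ker_unionP a : reflect (exists s : S, al s a = 0) (a \in ker_union).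
Proof. exact: asboolP. Qed.

Fact ker_union_zmod_closed : zmod_closed ker_union.
Proof.
split; first by apply/ker_unionP; exists 1%g; rewrite endr_act0.
move=> a b /ker_unionP[s sa] /ker_unionP[t tb]; apply/ker_unionP.
have [u [v uv]] := left_oreP s t; exists (u * t)%g.
rewrite endr_actB {1}uv !endr_act_mul sa tb !endr_act0 subrr //.
Qed.

HB.instance Definition _ := GRing.isZmodClosed.Build A ker_union
  ker_union_zmod_closed.

Fact ker_unionMl a b : b \in ker_union -> a * b \in ker_union.
Proof.
by case/ker_unionP=> s sb; apply/ker_unionP; exists s; rewrite endr_actM sb mulr0.
Qed.

Fact ker_unionMr a b : a \in ker_union -> a * b \in ker_union.
Proof.
by case/ker_unionP=> s sa; apply/ker_unionP; exists s; rewrite endr_actM sa mul0r.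
Qed.

Fact ker_union_act s a : (al s a \in ker_union) = (a \in ker_union).
Proof.
apply/ker_unionP/ker_unionP=> [[t ta]|[t ta]].
  by exists (t * s)%g; rewrite endr_act_mul.
have [u [v uv]] := left_oreP t s; exists u.
by rewrite -endr_act_mul uv endr_act_mul ta endr_act0.
Qed.

Definition quotI := Quotient.quot (GRing.ZmodClosed.clone A ker_union _).
HB.instance Definition _ := GRing.Zmodule.on quotI.
HB.instance Definition _ := Quotient.on quotI.

Definition quotI_pi (a : A) : quotI := \pi_quotI a.

Lemma quotI_eq a b : (quotI_pi a == quotI_pi b) = (a - b \in ker_union).
Proof. by rewrite /quotI_pi -Quotient.idealrBE. Qed.

Lemma quotI_eqP a b : a - b \in ker_union -> quotI_pi a = quotI_pi b.
Proof. by rewrite -quotI_eq => /eqP. Qed.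

Lemma quotI_reprP a : repr (quotI_pi a) - a \in ker_union.
Proof. by rewrite -quotI_eq /quotI_pi reprK. Qed.

Definition quotI_mul (x y : quotI) : quotI := quotI_pi (repr x * repr y).

Lemma quotI_piM a b : quotI_pi (a * b) = quotI_mul (quotI_pi a) (quotI_pi b).
Proof.
apply/esym/quotI_eqP; set a' := repr _; set b' := repr _.
have -> : a' * b' - a * b = (a' - a) * b' + a * (b' - b).
  by rewrite mulrBl mulrBr addrA subrK.
by apply: rpredD; [apply: ker_unionMr | apply: ker_unionMl]; apply: quotI_reprP.
Qed.

Lemma quotI_piB : zmod_morphism quotI_pi.
Proof. by move=> a b; rewrite /quotI_pi raddfB. Qed.

Lemma quotI_piD a b : quotI_pi (a + b) = quotI_pi a + quotI_pi b.
Proof. by rewrite /quotI_pi raddfD. Qed.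

Fact quotI_mulA : associative quotI_mul.
Proof.
elim/quotW=> x; elim/quotW=> y; elim/quotW=> z.
by rewrite -!/(quotI_pi _) -!quotI_piM mulrA.
Qed.
Fact quotI_mul1 : left_id (quotI_pi 1) quotI_mul.
Proof. by elim/quotW=> x; rewrite -!/(quotI_pi _) -!quotI_piM mul1r. Qed.
Fact quotI_mulr1 : right_id (quotI_pi 1) quotI_mul.
Proof. by elim/quotW=> x; rewrite -!/(quotI_pi _) -!quotI_piM mulr1. Qed.
Fact quotI_mulDl : left_distributive quotI_mul +%R.
Proof.
elim/quotW=> x; elim/quotW=> y; elim/quotW=> z.
by rewrite -!/(quotI_pi _) -!(quotI_piM, quotI_piD) mulrDl.
Qed.
Fact quotI_mulDr : right_distributive quotI_mul +%R.
Proof.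
elim/quotW=> x; elim/quotW=> y; elim/quotW=> z.
by rewrite -!/(quotI_pi _) -!(quotI_piM, quotI_piD) mulrDr.
Qed.

HB.instance Definition _ := GRing.Zmodule_isPzRing.Build quotI
  quotI_mulA quotI_mul1 quotI_mulr1 quotI_mulDl quotI_mulDr.

Fact quotI_pi_monoid : monoid_morphism quotI_pi.
Proof. by split=> // a b; rewrite quotI_piM. Qed.

HB.instance Definition _ := GRing.isZmodMorphism.Build A quotI quotI_pi quotI_piB.
HB.instance Definition _ :=
  GRing.isMonoidMorphism.Build A quotI quotI_pi quotI_pi_monoid.

Definition quotI_act_fun (s : S) (x : quotI) : quotI := quotI_pi (al s (repr x)).

Lemma quotI_act_pi s a : quotI_act_fun s (quotI_pi a) = quotI_pi (al s a).
Proof. by apply/quotI_eqP; rewrite -endr_actB ker_union_act quotI_reprP. Qed.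

Fact quotI_actD s : {morph quotI_act_fun s : x y / x + y}.
Proof.
elim/quotW=> x; elim/quotW=> y; rewrite -!/(quotI_pi _).
by rewrite -quotI_piD !quotI_act_pi endr_actD quotI_piD.
Qed.
Fact quotI_actM s : {morph quotI_act_fun s : x y / x * y}.
Proof.
elim/quotW=> x; elim/quotW=> y; rewrite -!/(quotI_pi _).
by rewrite -rmorphM !quotI_act_pi endr_actM rmorphM.
Qed.
Fact quotI_act1 x : quotI_act_fun 1%g x = x.
Proof. by elim/quotW: x => x; rewrite -!/(quotI_pi _) quotI_act_pi endr_act1. Qed.
Fact quotI_act_mul s t x :
  quotI_act_fun (s * t)%g x = quotI_act_fun s (quotI_act_fun t x).
Proof.
by elim/quotW: x => x; rewrite -!/(quotI_pi _) !quotI_act_pi endr_act_mul.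
Qed.

Definition quotI_act : endr_action S quotI :=
  EndrAction quotI_actD quotI_actM quotI_act1 quotI_act_mul.

Lemma quotI_act_inj s : injective (quotI_act s).
Proof.
elim/quotW=> x; elim/quotW=> y; rewrite -!/(quotI_pi _) /= !quotI_act_pi.
by move/eqP; rewrite quotI_eq -endr_actB ker_union_act -quotI_eq => /eqP.
Qed.

End QuotientByKernels.

Section SAS.
Variables (S : cancelLeftOreType) (A : pzRingType) (al : endr_action S A).
Variable R : fracSkewMonoidRing al.
Local Notation phi := (fsmr_phi R).
Local Notation m := (fsmr_m R).
Local Notation p := (fsmr_p R).
Let rel := fsmr_rel R.

(* [sas] is [S_- A S_+]. *)
Definition in_sas : pred R :=
  fun x => `[< exists s a, x = m s * phi a * p s >].

Lemma in_sasP x : reflect (exists s a, x = m s * phi a * p s) (x \in in_sas).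
Proof. exact: asboolP. Qed.

Lemma sas_scale u s a : m s * phi a * p s = m (u * s)%g * phi (al u a) * p (u * s)%g.
Proof.
rewrite (skew_mM rel) (skew_pM rel) -!mulrA; congr (_ * _).
rewrite [phi (al u a) * _]mulrA -(skew_pA rel) -mulrA.
by rewrite [m u * (p u * _)]mulrA (skew_mp rel) mul1r.
Qed.

Fact in_sas_subring_closed : subring_closed in_sas.
Proof.
split=> [|x y|x y].
- apply/in_sasP; exists 1%g, 1.
  by rewrite rmorph1 (skew_m1 rel) (skew_p1 rel) !mulr1.
- move=> /in_sasP[s [a ->]] /in_sasP[t [b ->]]; apply/in_sasP.
  have [u [v uv]] := left_oreP s t.
  exists (u * t)%g, (al v a - al u b).
  by rewrite (sas_scale v) (sas_scale u t) uv rmorphB mulrBr mulrBl.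
move=> /in_sasP[s [a ->]] /in_sasP[t [b ->]]; apply/in_sasP.
have [u [v uv]] := left_oreP s t; rewrite (sas_scale v) (sas_scale u t) uv.
exists (v * s)%g, (al v a * al (v * s)%g 1 * al u b).
by rewrite !rmorphM -(skew_pm rel) !mulrA.
Qed.

Definition sas := {x : R | x \in in_sas}.
HB.instance Definition _ := SubChoice.on sas.
HB.instance Definition _ :=
  GRing.SubChoice_isSubPzRing.Build R in_sas sas in_sas_subring_closed.

Fact sas_phi_subproof a : phi a \in in_sas.
Proof.
by apply/in_sasP; exists 1%g, a; rewrite (skew_m1 rel) (skew_p1 rel) mul1r mulr1.
Qed.

Definition sas_phi (a : A) : sas := Sub (phi a) (sas_phi_subproof a).

Fact sas_act_subproof t (x : sas) : p t * val x * m t \in in_sas.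
Proof.
have /in_sasP[s [a ->]] := valP x; apply/in_sasP.
have [u [v uv]] := left_oreP s t.
have [pmE pmE'] : p t * m s = m u * phi (al v (al s 1)) * p v /\
    p s * m t = m v * phi (al v (al s 1)) * p u.
  have pv : p v * (p s * m s) = phi (al v (al s 1)) * p v.
    by rewrite (skew_pm rel) (skew_pA rel).
  have mv : p s * m s * m v = m v * phi (al v (al s 1)).
    by rewrite (skew_pm rel) (skew_Am rel).
  split.
    rewrite -mulrA -pv (mulrA (p v)) -(skew_pM rel).
    by rewrite -uv (skew_pM rel) !mulrA (skew_mp rel) mul1r.
  rewrite -mv -!mulrA; congr (_ * _).
  rewrite (mulrA (m s)) -(skew_mM rel) -uv (skew_mM rel) -mulrA.
  by rewrite (skew_mp rel) mulr1.
exists u, (al v (al s 1) * al v a * al v 1 * al v (al s 1)).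
rewrite !mulrA pmE -(mulrA _ (p s)) pmE' !mulrA.
by rewrite -(mulrA _ (p v)) (skew_pA rel) !rmorphM -(skew_pm rel v) !mulrA.
Qed.

Definition sas_act_fun (t : S) (x : sas) : sas :=
  Sub (p t * val x * m t) (sas_act_subproof t x).

Fact sas_actD t : {morph sas_act_fun t : x y / x + y}.
Proof. by move=> x y; apply: val_inj; rewrite /= mulrDr mulrDl. Qed.
Fact sas_actM t : {morph sas_act_fun t : x y / x * y}.
Proof.
move=> x y; apply: val_inj => /=; rewrite !mulrA; congr (_ * _).
by rewrite -!mulrA [m t * (p t * _)]mulrA (skew_mp rel) mul1r.
Qed.
Fact sas_act1 x : sas_act_fun 1%g x = x.
Proof.
by apply: val_inj; rewrite /= (skew_m1 rel) (skew_p1 rel) mul1r mulr1.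
Qed.
Fact sas_act_mul s t x :
  sas_act_fun (s * t)%g x = sas_act_fun s (sas_act_fun t x).
Proof. by apply: val_inj; rewrite /= (skew_mM rel) (skew_pM rel) !mulrA. Qed.

Definition sas_act : endr_action S sas :=
  EndrAction sas_actD sas_actM sas_act1 sas_act_mul.

Lemma sas_act_inj t : injective (sas_act t).
Proof.
move=> x y /(congr1 val) /= xy; apply: val_inj.
have tK z : m t * (p t * z * m t) * p t = z.
  by rewrite -!mulrA (skew_mp rel) mulr1 mulrA (skew_mp rel) mul1r.
by rewrite -[LHS]tK xy tK.
Qed.

End SAS.

HB.mixin Record Zmodule_isNonUnitalRing R of GRing.Zmodule R := {
  numul : R -> R -> R;
  numulA : associative numul;
  numulDl : left_distributive numul +%R;
  numulDr : right_distributive numul +%R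
}.

#[short(type="nonUnitalRingType")]
HB.structure Definition NonUnitalRing :=
  { R of Zmodule_isNonUnitalRing R & GRing.Zmodule R }.

Notation "x ** y" := (numul x y) (at level 40, left associativity) : ring_scope.

Section NonUnitalRingTheory.
Variable R : nonUnitalRingType.
Implicit Types x y e f : R.

Lemma numul0 x : x ** 0 = 0.
Proof. by apply: (addrI (x ** 0)); rewrite -numulDr !addr0. Qed.
Lemma nu0mul x : 0 ** x = 0.
Proof. by apply: (addrI (0 ** x)); rewrite -numulDl !addr0. Qed.
Lemma numulN x y : x ** (- y) = - (x ** y).
Proof. by apply: (addrI (x ** y)); rewrite -numulDr !subrr numul0. Qed.
Lemma nuNmul x y : (- x) ** y = - (x ** y).
Proof. by apply: (addrI (x ** y)); rewrite -numulDl !subrr nu0mul. Qed.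
Lemma numulBr x y z : x ** (y - z) = x ** y - x ** z.
Proof. by rewrite numulDr numulN. Qed.
Lemma numulBl x y z : (x - y) ** z = x ** z - y ** z.
Proof. by rewrite numulDl nuNmul. Qed.
Lemma numul_sumr (I : Type) (r : seq I) (F : I -> R) x :
  x ** (\sum_(i <- r) F i) = \sum_(i <- r) x ** F i.
Proof. by apply: (big_morph _ (numulDr x) (numul0 x)). Qed.
Lemma numul_suml (I : Type) (r : seq I) (F : I -> R) x :
  (\sum_(i <- r) F i) ** x = \sum_(i <- r) F i ** x.
Proof.
by apply: (big_morph (fun y => y ** x)) => [y z|]; rewrite ?numulDl ?nu0mul.
Qed.

Definition is_idempotent e : Prop := e ** e = e.

Definition idempotent_le e f : Prop := e = e ** f /\ e = f ** e.

End NonUnitalRingTheory.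

Section Localization.
Variables (S : cancelLeftOreType) (B : pzRingType) (be : endr_action S B).

Definition loc_rel (x y : S * B) : bool :=
  `[< exists t1 t2 : S, (t1 * x.1 = t2 * y.1)%g /\ be t1 x.2 = be t2 y.2 >].

Fact loc_rel_equiv : equiv_class_of loc_rel.
Proof.
split=> [x|x y|y x z]; first by apply/asboolP; exists 1%g, 1%g.
  by apply/asboolP/asboolP=> -[t1 [t2 [? ?]]]; exists t2, t1.
move=> /asboolP[t1 [t2 [t12 b12]]] /asboolP[u2 [u3 [u23 b23]]].
apply/asboolP; have [w [v vw]] := left_oreP u2 t2.
exists (w * t1)%g, (v * u3)%g.
rewrite -!mulgA t12 -u23 !mulgA vw; split=> //.
by rewrite !endr_act_mul b12 -b23 -!endr_act_mul vw.
Qed.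

Canonical loc_equiv := EquivRelPack loc_rel_equiv.

Definition loc := {eq_quot loc_rel}.
HB.instance Definition _ := Choice.on loc.
HB.instance Definition _ := EqQuotient.on loc.

Definition frac (s : S) (b : B) : loc := \pi_loc (s, b).

Lemma fracP s1 b1 s2 b2 :
  frac s1 b1 = frac s2 b2 <->
  exists t1 t2, (t1 * s1 = t2 * s2)%g /\ be t1 b1 = be t2 b2.
Proof.
split=> [/(eqquotP loc)/asboolP //|e12].
by apply/(eqquotP loc)/asboolP.
Qed.

Lemma frac_scale t s b : frac s b = frac (t * s)%g (be t b).
Proof. by apply/fracP; exists t, 1%g; rewrite mul1g endr_act1. Qed.

Lemma locW (x : loc) : exists s b, x = frac s b.
Proof. by elim/quotW: x => -[s b]; exists s, b. Qed.

Lemma locW2 (x y : loc) : exists s a b, x = frac s a /\ y = frac s b.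
Proof.
have [s [a ->]] := locW x; have [t [b ->]] := locW y.
have [u [v uv]] := left_oreP s t.
exists (u * t)%g, (be v a), (be u b); rewrite -frac_scale; split=> //.
by rewrite uv -frac_scale.
Qed.

Lemma locW3 (x y z : loc) :
  exists s a b c, [/\ x = frac s a, y = frac s b & z = frac s c].
Proof.
have [s [a [b [-> ->]]]] := locW2 x y; have [t [c ->]] := locW z.
have [u [v uv]] := left_oreP s t.
exists (u * t)%g, (be v a), (be v b), (be u c).
by rewrite -frac_scale uv -!frac_scale.
Qed.

(* The choice of a common denominator is immaterial: see [fracD], [fracM]. *)
Definition loc_op (op : B -> B -> B) (x y : loc) : loc :=
  let: (s1, b1) := repr x in let: (s2, b2) := repr y in
  let: exist t1 Ht := cid (left_oreP s2 s1) in
  let: exist t2 _ := cid Ht in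
  frac (t1 * s1)%g (op (be t1 b1) (be t2 b2)).

Lemma loc_opE op s1 b1 s2 b2 t1 t2 :
    (forall s, {morph be s : x y / op x y}) -> (t1 * s1 = t2 * s2)%g ->
  loc_op op (frac s1 b1) (frac s2 b2) =
    frac (t1 * s1)%g (op (be t1 b1) (be t2 b2)).
Proof.
move=> opM t12; rewrite /loc_op.
case E1: (repr _) => [s1' b1']; case E2: (repr _) => [s2' b2'].
case: cid => u1 Hu; case: cid => u2 u12.
have /fracP[c1 [d1 [cd1 be1]]] : frac s1 b1 = frac s1' b1'.
  by rewrite /frac -E1 reprK.
have /fracP[c2 [d2 [cd2 be2]]] : frac s2 b2 = frac s2' b2'.
  by rewrite /frac -E2 reprK.
have mulIS := (cancellativeP (s := S)).2.
(* make the four denominators [t1 s1, u1 s1', c1 s1, c2 s2] equal *)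
have [a [a' aE]] := left_oreP (u1 * s1')%g (t1 * s1)%g.
have [b [b' bE]] := left_oreP (c1 * s1)%g (a * (t1 * s1))%g.
have [c [c' cE]] := left_oreP (c2 * s2)%g (b * (a * (t1 * s1)))%g.
have k1 : (c * b * a * t1 = c * b' * c1)%g.
  by apply: (mulIS s1); rewrite -!mulgA bE.
have k2 : (c * b * a * t2 = c' * c2)%g.
  by apply: (mulIS s2); rewrite -!mulgA -t12 cE.
have k1' : (c * b * a' * u1 = c * b' * d1)%g.
  by apply: (mulIS s1'); rewrite -!mulgA -aE -cd1 bE.
have k2' : (c * b * a' * u2 = c' * d2)%g.
  by apply: (mulIS s2'); rewrite -!mulgA -u12 -aE -cd2 cE.
apply/esym/fracP; exists (c * b * a)%g, (c * b * a')%g; split.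
  by rewrite -!mulgA aE.
rewrite !opM -!endr_act_mul k1 k1' k2 k2'.
by rewrite !(endr_act_mul _ (c * b')%g) !(endr_act_mul _ c') be1 be2.
Qed.

Lemma loc_opEs op s b1 b2 : (forall s, {morph be s : x y / op x y}) ->
  loc_op op (frac s b1) (frac s b2) = frac s (op b1 b2).
Proof.
move=> opM; rewrite (@loc_opE _ _ _ _ _ 1%g 1%g opM erefl).
by rewrite !endr_act1 mul1g.
Qed.

Definition loc_add := locked (loc_op +%R).
Definition loc_mul := locked (loc_op *%R).
Definition loc_opp := locked (fun x : loc => let: (s, b) := repr x in frac s (- b)).

Lemma loc_addEs s a b : loc_add (frac s a) (frac s b) = frac s (a + b).
Proof. by rewrite /loc_add -lock loc_opEs // => ?; apply: endr_actD. Qed.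
Lemma loc_mulEs s a b : loc_mul (frac s a) (frac s b) = frac s (a * b).
Proof. by rewrite /loc_mul -lock loc_opEs // => ?; apply: endr_actM. Qed.
Lemma loc_oppE s a : loc_opp (frac s a) = frac s (- a).
Proof.
rewrite /loc_opp -lock; case E: (repr _) => [t b].
have /fracP[u [v [uv ab]]] : frac s a = frac t b by rewrite /frac -E reprK.
by apply/fracP; exists v, u; rewrite uv !endr_actN ab.
Qed.

Lemma frac0 s t : frac s 0 = frac t 0.
Proof.
by have [u [v uv]] := left_oreP s t; apply/fracP; exists v, u; rewrite !endr_act0.
Qed.

Fact loc_addA : associative loc_add.
Proof.
move=> x y z; have [s [a [b [c [-> -> ->]]]]] := locW3 x y z.
by rewrite !loc_addEs addrA.
Qed.
Fact loc_addC : commutative loc_add.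
Proof.
move=> x y; have [s [a [b [-> ->]]]] := locW2 x y.
by rewrite !loc_addEs addrC.
Qed.
Fact loc_add0 : left_id (frac 1%g 0) loc_add.
Proof.
by move=> x; have [s [a ->]] := locW x; rewrite (frac0 _ s) loc_addEs add0r.
Qed.
Fact loc_addN : left_inverse (frac 1%g 0) loc_opp loc_add.
Proof.
move=> x; have [s [a ->]] := locW x.
by rewrite loc_oppE loc_addEs addNr (frac0 _ s).
Qed.
Fact loc_mulA : associative loc_mul.
Proof.
move=> x y z; have [s [a [b [c [-> -> ->]]]]] := locW3 x y z.
by rewrite !loc_mulEs mulrA.
Qed.
Fact loc_mulDl : left_distributive loc_mul loc_add.
Proof.
move=> x y z; have [s [a [b [c [-> -> ->]]]]] := locW3 x y z.
by rewrite !(loc_mulEs, loc_addEs) mulrDl.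
Qed.
Fact loc_mulDr : right_distributive loc_mul loc_add.
Proof.
move=> x y z; have [s [a [b [c [-> -> ->]]]]] := locW3 x y z.
by rewrite !(loc_mulEs, loc_addEs) mulrDr.
Qed.

HB.instance Definition _ := GRing.isZmodule.Build loc
  loc_addA loc_addC loc_add0 loc_addN.
HB.instance Definition _ := Zmodule_isNonUnitalRing.Build loc
  loc_mulA loc_mulDl loc_mulDr.

Lemma fracD s1 b1 s2 b2 t1 t2 : (t1 * s1 = t2 * s2)%g ->
  frac s1 b1 + frac s2 b2 = frac (t1 * s1)%g (be t1 b1 + be t2 b2).
Proof.
move=> t12; rewrite -[_ + _ in LHS]/(loc_add _ _) /loc_add -lock.
by rewrite (loc_opE _ _ _ t12) // => ?; apply: endr_actD.
Qed.

Lemma fracM s1 b1 s2 b2 t1 t2 : (t1 * s1 = t2 * s2)%g ->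
  frac s1 b1 ** frac s2 b2 = frac (t1 * s1)%g (be t1 b1 * be t2 b2).
Proof.
move=> t12; rewrite -[_ ** _ in LHS]/(loc_mul _ _) /loc_mul -lock.
by rewrite (loc_opE _ _ _ t12) // => ?; apply: endr_actM.
Qed.

End Localization.

(* Bijectivity of each [aut_act g] follows from the group laws, see
   [aut_act_bij]. *)
Record aut_action (G : groupType) (C : nonUnitalRingType) := AutAction {
  aut_act :> G -> C -> C;
  aut_actD : forall g, {morph aut_act g : x y / x + y};
  aut_actM : forall g, {morph aut_act g : x y / x ** y};
  aut_act1 : forall x, aut_act 1%g x = x;
  aut_act_mul : forall g h x, aut_act (g * h)%g x = aut_act g (aut_act h x)
}.

Lemma aut_act_bij (G : groupType) (C : nonUnitalRingType)
  (a : aut_action G C) g : bijective (a g).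
Proof.
by exists (a g^-1%g) => x; rewrite -aut_act_mul ?mulVg ?mulgV aut_act1.
Qed.

Section SkewGroupRing.
Variables (G : groupType) (C : nonUnitalRingType) (a : aut_action G C).

(* Finitely supported functions [G -> C]; [<< c *g g >>] stands for [c g]. The
   argument [a] keeps apart the products given by different actions. *)
Definition skew_group_ring of aut_action G C := {malg C[G]}.
Local Notation CG := (skew_group_ring a).
HB.instance Definition _ := GRing.Zmodule.on CG.

Definition sgr_mul (x y : CG) : CG :=
  \sum_(g <- msupp x) \sum_(h <- msupp y)
    << x@_g ** a g y@_h *g (g * h)%g >>.

Lemma aut_act0 g : a g 0 = 0.
Proof. by apply: (addrI (a g 0)); rewrite -aut_actD !addr0. Qed.

Lemma sgr_mulEw (x y : CG) (X Y : {fset G}) :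
    (msupp x `<=` X)%fset -> (msupp y `<=` Y)%fset ->
  sgr_mul x y = \sum_(g <- X) \sum_(h <- Y) << x@_g ** a g y@_h *g (g * h)%g >>.
Proof.
move=> sX sY; rewrite /sgr_mul (big_fset_incl _ sX) /=.
  apply: eq_bigr => g _; rewrite (big_fset_incl _ sY) // => h _.
  by move/mcoeff_outdom->; rewrite aut_act0 numul0 monalgU0.
move=> g _ /mcoeff_outdom xg; rewrite big1 // => h _.
by rewrite xg nu0mul monalgU0.
Qed.

Fact sgr_mulDl : left_distributive sgr_mul +%R.
Proof.
move=> x y z; pose X := (msupp x `|` msupp y)%fset.
rewrite (@sgr_mulEw x z X (msupp z)) ?fsubsetUl //.
rewrite (@sgr_mulEw y z X (msupp z)) ?fsubsetUr //.
rewrite (@sgr_mulEw (x + y) z X (msupp z)) ?msuppD_le //.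
rewrite -big_split; apply: eq_bigr => g _; rewrite -big_split.
by apply: eq_bigr => h _; rewrite mcoeffD numulDl monalgUD.
Qed.

Fact sgr_mulDr : right_distributive sgr_mul +%R.
Proof.
move=> z x y; pose X := (msupp x `|` msupp y)%fset.
rewrite (@sgr_mulEw z x (msupp z) X) ?fsubsetUl //.
rewrite (@sgr_mulEw z y (msupp z) X) ?fsubsetUr //.
rewrite (@sgr_mulEw z (x + y) (msupp z) X) ?msuppD_le //.
rewrite -big_split; apply: eq_bigr => g _; rewrite -big_split.
by apply: eq_bigr => h _; rewrite mcoeffD aut_actD numulDr monalgUD.
Qed.

Lemma sgr_mulU c g d h :
  sgr_mul << c *g g >> << d *g h >> = << c ** a g d *g (g * h)%g >>.
Proof.
rewrite (@sgr_mulEw _ _ [fset g]%fset [fset h]%fset) ?msuppU_le //.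
by rewrite !big_seq_fset1 !mcoeffUU.
Qed.

Lemma sgr_mul0 x : sgr_mul x 0 = 0.
Proof. by apply: (addrI (sgr_mul x 0)); rewrite -sgr_mulDr !addr0. Qed.
Lemma sgr_0mul x : sgr_mul 0 x = 0.
Proof. by apply: (addrI (sgr_mul 0 x)); rewrite -sgr_mulDl !addr0. Qed.

Lemma sgr_ind (P : CG -> Prop) :
    P 0 -> (forall x y, P x -> P y -> P (x + y)) ->
    (forall c g, P << c *g g >>) -> forall x, P x.
Proof.
move=> P0 PD PU x; rewrite [x](monalgEw (fsubset_refl _)).
by apply: big_ind => [||g _] //; apply: PD.
Qed.

Fact sgr_mulA : associative sgr_mul.
Proof.
move=> x y z; elim/sgr_ind: x => [|x x' IHx IHx'|c g].
- by rewrite !sgr_0mul.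
- by rewrite !sgr_mulDl IHx IHx'.
elim/sgr_ind: y => [|y y' IHy IHy'|d h].
- by rewrite sgr_0mul !sgr_mul0 sgr_0mul.
- by rewrite !(sgr_mulDl, sgr_mulDr) IHy IHy'.
elim/sgr_ind: z => [|z z' IHz IHz'|e k].
- by rewrite !sgr_mul0.
- by rewrite !sgr_mulDr IHz IHz'.
by rewrite !sgr_mulU aut_actM numulA mulgA aut_act_mul.
Qed.

HB.instance Definition _ := Zmodule_isNonUnitalRing.Build CG
  sgr_mulA sgr_mulDl sgr_mulDr.

Definition sgr_incl (c : C) : CG := << c *g 1%g >>.

Lemma sgr_incl_idem e : is_idempotent e -> is_idempotent (sgr_incl e).
Proof.
move=> ee; rewrite /is_idempotent -[LHS]/(sgr_mul _ _) sgr_mulU aut_act1 mulg1.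
by rewrite ee.
Qed.

End SkewGroupRing.

Section Corner.
Variables (D : nonUnitalRingType) (e : D) (ee : is_idempotent e).

Definition in_corner : pred D := fun x => `[< exists y, x = e ** y ** e >].

Lemma in_cornerP x : reflect (exists y, x = e ** y ** e) (x \in in_corner).
Proof. exact: asboolP. Qed.

(* [ee] is an argument since it is what makes [corner] a unital ring. *)
Definition corner of is_idempotent e := {x : D | x \in in_corner}.
Local Notation eDe := (corner ee).
HB.instance Definition _ := SubChoice.on eDe.

Fact in_corner_zmod_closed : zmod_closed in_corner.
Proof.
split; first by apply/in_cornerP; exists 0; rewrite numul0 nu0mul.
move=> _ _ /in_cornerP[x ->] /in_cornerP[y ->]; apply/in_cornerP.
by exists (x - y); rewrite numulBr numulBl.
Qed.

HB.instance Definition _ :=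
  GRing.SubChoice_isSubZmodule.Build D in_corner eDe in_corner_zmod_closed.

Fact in_corner_e : e \in in_corner.
Proof. by apply/in_cornerP; exists e; rewrite !ee. Qed.

Fact in_corner_mul (x y : eDe) : val x ** val y \in in_corner.
Proof.
have /in_cornerP[x' ->] := valP x; have /in_cornerP[y' ->] := valP y.
by apply/in_cornerP; exists (x' ** e ** e ** y'); rewrite !numulA.
Qed.

Definition corner_one : eDe := Sub e in_corner_e.
Definition corner_mul (x y : eDe) : eDe :=
  Sub (val x ** val y) (in_corner_mul x y).

Fact corner_mulA : associative corner_mul.
Proof. by move=> x y z; apply: val_inj; rewrite /= numulA. Qed.
Fact corner_mul1 : left_id corner_one corner_mul.
Proof.
move=> x; apply: val_inj => /=; have /in_cornerP[y ->] := valP x.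
by rewrite !numulA ee.
Qed.
Fact corner_mulr1 : right_id corner_one corner_mul.
Proof.
move=> x; apply: val_inj => /=; have /in_cornerP[y ->] := valP x.
by rewrite -!numulA ee.
Qed.
Fact corner_mulDl : left_distributive corner_mul +%R.
Proof. by move=> x y z; apply: val_inj; rewrite /= numulDl. Qed.
Fact corner_mulDr : right_distributive corner_mul +%R.
Proof. by move=> x y z; apply: val_inj; rewrite /= numulDr. Qed.

HB.instance Definition _ := GRing.Zmodule_isPzRing.Build eDe
  corner_mulA corner_mul1 corner_mulr1 corner_mulDl corner_mulDr.

End Corner.

(* As [e] has degree [1], the induced grading of [e (C * G) e] is given by the
   intersections with the components [C g]. *)
Definition corner_component (G : groupType) (C : nonUnitalRingType)
    (a : aut_action G C) (e : C) (ee : is_idempotent e) (g : G)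
    (x : corner (sgr_incl_idem a ee)) : Prop :=
  exists c : C, val x = (<< c *g g >> : skew_group_ring a).

Section Statement.
Variables (S : cancelLeftOreType) (A : pzRingType) (al : endr_action S A).
Variable Q : fracSkewMonoidRing (quotI_act al).

(* [S^-1 (S_- (A/I) S_+)], and the class [[1, a + I]] in it *)
Definition loc_sas := loc (sas_act Q).
HB.instance Definition _ := NonUnitalRing.on loc_sas.

Definition loc_sas_of (a : A) : loc_sas :=
  frac (sas_act Q) 1%g (sas_phi Q (quotI_pi al a)).

End Statement.

(* Main.v *)
From HB Require Import structures.
Require Import Defs.
From mathcomp Require Import all_boot ssralg.
From mathcomp Require Import finmap boolp monalg.

(** Write [B = S_- (A/I) S_+], [C = S^-1 B] and [e = [1, 1]] in [C]. The group
    [G] acts on [C] by [g [t, b] = [u, v b]] whenever [g t^-1 = u^-1 v], and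
    [phi a |-> [1, a]], [s_- |-> e s^-1], [s_+ |-> s e] satisfy the skew
    relations in the corner [e (C * G) e], whence a map [Phi] out of [R].
    [R] is the sum of its components, [Phi] is graded, and
    [Phi (s_- phi(a) t_+) = [s, p_s a p_t] s^-1 t]; as every class in [C] can be
    written [[s, a]] with [a] in [A/I], these elements fill the homogeneous
    components of the corner. If [Phi (s_- phi(a) t_+) = 0] then
    [p_s a p_t] lies in [I], so is killed by some [alpha_u], and
    [s_- phi(a) t_+ = (u s)_- phi(alpha_u (p_s a p_t)) (u t)_+ = 0].

    This requires [A/I] to embed into its fractional skew monoid ring: the same
    corner built on [S^-1 (A/I)] is a target in which [A/I] embeds. *)

Set Implicit Arguments.
Unset Strict Implicit.
Unset Printing Implicit Defensive.

Import GRing.Theory.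
Local Open Scope ring_scope.

(** * The action of [G] on [S^-1 B] *)

Section AutAction.
Variables (S : cancelLeftOreType) (G : groupType) (iota : S -> G).
Hypothesis iotaP : left_fraction_group iota.
Variables (B : pzRingType) (be : endr_action S B).

(** Scaling by [w u = w' u'] gives a common denominator, and injectivity of [iota] then yields
    [w v t = w' v' t']. A further common multiple with [c t = c' t'] and right cancellation reduce
    equality of the numerators to [c b = c' b']. *)
Lemma frac_act_wd g t b u v t' b' u' v' :
    frac be t b = frac be t' b' ->
    (iota u * g = iota (v * t))%g -> (iota u' * g = iota (v' * t'))%g ->
  frac be u (be v b) = frac be u' (be v' b').
Proof.
move=> /fracP[c [c' [ct cb]]] ug u'g.
have mulIS := (cancellativeP (s := S)).2.
have [w [w' wu]] := left_oreP u' u.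
have wvt : (w * v * t = w' * v' * t')%g.
  apply: (lfg_inj iotaP); rewrite -!mulgA !(lfgM iotaP w) !(lfgM iotaP w').
  by rewrite -ug -u'g !mulgA -!(lfgM iotaP) wu.
have [k [k' kE]] := left_oreP (c * t)%g (w * v * t)%g.
have kv : (k * w * v = k' * c)%g by apply: (mulIS t); rewrite -!mulgA -kE -!mulgA.
have kv' : (k * w' * v' = k' * c')%g.
  by apply: (mulIS t'); rewrite -!mulgA -ct -kE wvt -!mulgA.
apply/fracP; exists (k * w)%g, (k * w')%g; split; first by rewrite -!mulgA wu.
by rewrite -!endr_act_mul kv kv' !endr_act_mul cb.
Qed.

Lemma frac_act_den g t : exists u v, (iota u * g = iota (v * t))%g.
Proof.
have [u [v uv]] := lfg_frac iotaP (g * (iota t)^-1)%g.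
by exists u, v; rewrite (lfgM iotaP) -[g](mulgVK (iota t)) uv !mulgA mulgV mul1g.
Qed.

(** Quantifying over all presentations inside the existential lets the value picked by choice in
    [frac_act] be computed from any of them. *)
Lemma frac_act_ex g (x : loc be) : exists y : loc be, forall t b u v,
  x = frac be t b -> (iota u * g = iota (v * t))%g -> y = frac be u (be v b).
Proof.
have [t [b ->]] := locW x; have [u [v uv]] := frac_act_den g t.
by exists (frac be u (be v b)) => t' b' u' v' tb; apply: frac_act_wd tb uv.
Qed.

Definition frac_act g x : loc be := sval (cid (frac_act_ex g x)).

Lemma frac_actE g t b u v : (iota u * g = iota (v * t))%g ->
  frac_act g (frac be t b) = frac be u (be v b).
Proof. by rewrite /frac_act; case: cid => y /= + ug; apply; rewrite ?ug. Qed.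

Lemma loc_addE t a b : frac be t a + frac be t b = frac be t (a + b).
Proof. by rewrite (@fracD _ _ _ _ _ _ _ 1%g 1%g) // !endr_act1 mul1g. Qed.

Lemma loc_mulE t a b : frac be t a ** frac be t b = frac be t (a * b).
Proof. by rewrite (@fracM _ _ _ _ _ _ _ 1%g 1%g) // !endr_act1 mul1g. Qed.

Fact frac_actD g : {morph frac_act g : x y / x + y}.
Proof.
move=> x y; have [t [a [b [-> ->]]]] := locW2 x y.
have [u [v uv]] := frac_act_den g t.
by rewrite loc_addE !(frac_actE _ uv) endr_actD loc_addE.
Qed.

Fact frac_actM g : {morph frac_act g : x y / x ** y}.
Proof.
move=> x y; have [t [a [b [-> ->]]]] := locW2 x y.
have [u [v uv]] := frac_act_den g t.
by rewrite loc_mulE !(frac_actE _ uv) endr_actM loc_mulE.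
Qed.

Fact frac_act1 x : frac_act 1%g x = x.
Proof.
have [t [b ->]] := locW x.
by rewrite (@frac_actE _ _ _ t 1%g) ?endr_act1 // mulg1 mul1g.
Qed.

Fact frac_act_mul g h x : frac_act (g * h)%g x = frac_act g (frac_act h x).
Proof.
have [t [b ->]] := locW x; have [u [v uv]] := frac_act_den h t.
have [u' [v' uv']] := frac_act_den g u.
rewrite (frac_actE _ uv) (frac_actE _ uv') -endr_act_mul; apply: frac_actE.
by rewrite mulgA uv' (lfgM iotaP) -!mulgA uv -(lfgM iotaP).
Qed.

Definition frac_aut : aut_action G (loc be) :=
  AutAction frac_actD frac_actM frac_act1 frac_act_mul.

Lemma frac_autE g t b u v : (iota u * g = iota (v * t))%g ->
  frac_aut g (frac be t b) = frac be u (be v b).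
Proof. exact: frac_actE. Qed.

Lemma frac_aut1 s b : frac_aut (iota s) (frac be 1%g b) = frac be 1%g (be s b).
Proof. by apply: frac_autE; rewrite (lfg1 iotaP) mul1g mulg1. Qed.

Lemma frac_autV s b : frac_aut (iota s)^-1%g (frac be 1%g b) = frac be s b.
Proof.
rewrite (@frac_autE _ _ _ s 1%g) ?endr_act1 //.
by rewrite mulg1 (lfg1 iotaP) mulgV.
Qed.

Definition loc_idem : loc be := frac be 1%g 1.

Fact loc_idemP : is_idempotent loc_idem.
Proof. by rewrite /is_idempotent loc_mulE mul1r. Qed.

Lemma frac_den s b : frac be s (be s b) = frac be 1%g b.
Proof. by rewrite (frac_scale be s 1%g) mulg1. Qed.

Lemma loc_idem_mull s b : loc_idem ** frac be s b = frac be s (be s 1 * b).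
Proof. by rewrite /loc_idem (frac_scale be s 1%g) mulg1 loc_mulE. Qed.

(** In the corner, the coefficient of [g = s^-1 t] is cut on the right by [g e], which is
    [[s, p_t]]. *)
Lemma loc_idem_mulr s t b :
  frac be s b ** frac_aut ((iota s)^-1 * iota t)%g loc_idem
  = frac be s (b * be t 1).
Proof.
rewrite (@frac_autE _ _ _ s t) ?loc_mulE //.
by rewrite mulgA mulgV mul1g mulg1.
Qed.

End AutAction.

(** * The skew relations in the corner, for an equivariant morphism [f : A -> B] *)

Section CornerModel.
Variables (S : cancelLeftOreType) (G : groupType) (iota : S -> G).
Hypothesis iotaP : left_fraction_group iota.
Variables (A B : pzRingType) (al : endr_action S A) (be : endr_action S B).
Variable f : {rmorphism A -> B}.
Hypothesis f_act : forall s a, f (al s a) = be s (f a).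

Local Notation ah := (frac_aut iotaP be).
Local Notation e := (loc_idem be).
Local Notation CG := (skew_group_ring ah).
Local Notation eCGe := (corner (sgr_incl_idem ah (@loc_idemP S B be))).

Lemma skewU_mul (c d : loc be) g h :
  (<< c *g g >> : CG) ** (<< d *g h >> : CG) = << c ** ah g d *g (g * h)%g >>.
Proof. exact: sgr_mulU. Qed.

Lemma in_cornerU (c : loc be) g : e ** c = c -> c ** ah g e = c ->
  (<< c *g g >> : CG) \in in_corner (sgr_incl ah e).
Proof.
move=> ec ce; apply/in_cornerP; exists << c *g g >>.
by rewrite /sgr_incl !skewU_mul mul1g mulg1 aut_act1 ec ce.
Qed.

Fact corner_phi_subproof a :
  (<< frac be 1%g (f a) *g 1%g >> : CG) \in in_corner (sgr_incl ah e).
Proof.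
by apply: in_cornerU; rewrite ?aut_act1 !loc_mulE (mul1r, mulr1).
Qed.

Fact corner_m_subproof s :
  (<< e *g (iota s)^-1%g >> : CG) \in in_corner (sgr_incl ah e).
Proof.
apply: in_cornerU; first exact: loc_idemP.
by rewrite frac_autV loc_idem_mull mulr1 frac_den.
Qed.

Fact corner_p_subproof s :
  (<< frac be 1%g (be s 1) *g iota s >> : CG) \in in_corner (sgr_incl ah e).
Proof.
apply: in_cornerU; first by rewrite loc_mulE mul1r.
by rewrite frac_aut1 loc_mulE -endr_actM mulr1.
Qed.

Definition corner_phi a : eCGe :=
  Sub (<< frac be 1%g (f a) *g 1%g >> : CG) (corner_phi_subproof a).
Definition corner_m s : eCGe :=
  Sub (<< e *g (iota s)^-1%g >> : CG) (corner_m_subproof s).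
(** This is [s e] with its coefficient on the left: moving [e] across [s] turns it into
    [[1, p_s]]. *)
Definition corner_p s : eCGe :=
  Sub (<< frac be 1%g (be s 1) *g iota s >> : CG) (corner_p_subproof s).

Lemma val_cornerM (x y : eCGe) : val (x * y) = val x ** val y.
Proof. by []. Qed.

Fact corner_phi_zmod : zmod_morphism corner_phi.
Proof.
move=> a b; apply: val_inj; rewrite [RHS]raddfB /= -monalgUB; congr << _ *g _ >>.
apply: (addIr (frac be 1%g (f b))).
by rewrite subrK loc_addE -rmorphD subrK.
Qed.

Fact corner_phi_monoid : monoid_morphism corner_phi.
Proof.
split=> [|a b]; apply: val_inj; first by rewrite /= rmorph1.
by rewrite val_cornerM /= skewU_mul aut_act1 loc_mulE mulg1 rmorphM.
Qed.

HB.instance Definition _ :=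
  GRing.isZmodMorphism.Build A eCGe corner_phi corner_phi_zmod.
HB.instance Definition _ :=
  GRing.isMonoidMorphism.Build A eCGe corner_phi corner_phi_monoid.

(** Serves twice: with [f] the identity, to embed a ring with injective action into its fractional
    skew monoid ring, and with [f : A -> S_- (A/I) S_+]. *)
Lemma corner_relations : skew_relations al corner_phi corner_m corner_p.
Proof.
have ebe s : e ** frac be s (be s 1) = e.
  by rewrite loc_idem_mull -endr_actM mulr1 frac_den.
have es s : e ** frac be s 1 = e.
  by rewrite loc_idem_mull mulr1 frac_den.
split=> [|s t||s t|s a|s a|s|s]; apply: val_inj; rewrite ?val_cornerM /=
    ?skewU_mul.
- by rewrite (lfg1 iotaP) invg1.
- by rewrite frac_autV es (lfgM iotaP) invgM.
- by rewrite (lfg1 iotaP) endr_act1.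
- by rewrite frac_aut1 loc_mulE -endr_actM mul1r (lfgM iotaP) endr_act_mul.
- by rewrite frac_aut1 aut_act1 !loc_mulE f_act -!endr_actM mul1r mulr1 mulg1 mul1g.
- rewrite aut_act1 mul1g mulg1 frac_autV f_act frac_den.
  by rewrite /loc_idem !loc_mulE mul1r mulr1.
- by rewrite frac_autV mulVg ebe.
- by rewrite frac_aut1 mulgV loc_mulE f_act rmorph1 -endr_actM mulr1.
Qed.

(** Moving [s^-1] across turns [[1, f a]] and [[1, p_t]] into [[s, f a]] and [[s, p_t]]; the factor
    [e] of [s_-] contributes [p_s]. *)
Lemma val_corner_homog s a t :
  val (corner_m s * corner_phi a * corner_p t) =
  << frac be s (be s 1 * f a * be t 1) *g ((iota s)^-1 * iota t)%g >>.
Proof.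
rewrite !val_cornerM /= !skewU_mul mulg1 !frac_autV -numulA loc_mulE.
by rewrite loc_idem_mull mulrA.
Qed.

End CornerModel.

(** * The fractional skew monoid ring is generated by [phi], [m] and [p] *)

Section SubringInduction.
Variables (S : cancelLeftOreType) (A : pzRingType) (al : endr_action S A).
Variable R : fracSkewMonoidRing al.
Variables (P : pred R) (PP : subring_closed P).
Hypotheses (Pphi : forall a, fsmr_phi R a \in P).
Hypotheses (Pm : forall s, fsmr_m R s \in P) (Pp : forall s, fsmr_p R s \in P).

Definition subring of subring_closed P := {x : R | x \in P}.
Local Notation T := (subring PP).
HB.instance Definition _ := SubChoice.on T.
HB.instance Definition _ := GRing.SubChoice_isSubPzRing.Build R P T PP.

Definition subring_phi a : T := Sub (fsmr_phi R a) (Pphi a).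

Fact subring_phi_zmod : zmod_morphism subring_phi.
Proof. by move=> a b; apply: val_inj; rewrite /= raddfB. Qed.

Fact subring_phi_monoid : monoid_morphism subring_phi.
Proof.
by split=> [|a b]; apply: val_inj; rewrite /= ?rmorph1 ?rmorphM.
Qed.

HB.instance Definition _ :=
  GRing.isZmodMorphism.Build A T subring_phi subring_phi_zmod.
HB.instance Definition _ :=
  GRing.isMonoidMorphism.Build A T subring_phi subring_phi_monoid.

(* By universality [R] maps to the subring [T]; composed with [T <= R] this is
   an endomorphism fixing the generators, hence the identity. *)
Lemma fsmr_subring_ind r : r \in P.
Proof.
have [m1 mM p1 pM pA Am mp pm] := fsmr_rel R.
have rel : skew_relations al subring_phi (fun s => Sub (fsmr_m R s) (Pm s) : T)
    (fun s => Sub (fsmr_p R s) (Pp s) : T).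
  by split=> *; apply: val_inj => /=;
    rewrite ?(m1, mM, p1, pM, pA, Am, mp, pm).
have [F [Fphi Fm Fp _]] := fsmr_univ R rel.
have [H [_ _ _ Huniq]] := fsmr_univ R (fsmr_rel R).
have Fr : val (F r) = r.
  have -> : val (F r) = H r.
    apply: (Huniq (val \o F : {rmorphism R -> R})) => x /=.
    - by move: (Fphi x) => /= ->.
    - by move: (Fm x) => /= ->.
    - by move: (Fp x) => /= ->.
  by apply/esym/(Huniq idfun).
by rewrite -Fr (valP (F r)).
Qed.

End SubringInduction.

(** * Homogeneous decomposition in the fractional skew monoid ring *)

Section Grading.
Variables (S : cancelLeftOreType) (G : groupType) (iota : S -> G).
Hypothesis iotaP : left_fraction_group iota.
Variables (A : pzRingType) (al : endr_action S A) (R : fracSkewMonoidRing al).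
Local Notation phi := (fsmr_phi R).
Local Notation m := (fsmr_m R).
Local Notation p := (fsmr_p R).
Local Notation comp := (@fsmr_component S A al R G iota).
Let rel := fsmr_rel R.

(** Since [u_- u_+ = 1], [u_- phi(alpha_u(a)) u_+ = u_- u_+ phi(a) = phi(a)]. *)
Lemma fsmr_scale u s a t :
  m s * phi a * p t = m (u * s)%g * phi (al u a) * p (u * t)%g.
Proof.
rewrite (skew_mM rel) (skew_pM rel) -!mulrA; congr (_ * _).
rewrite [phi (al u a) * _]mulrA -(skew_pA rel) -mulrA.
by rewrite [m u * (p u * _)]mulrA (skew_mp rel) mul1r.
Qed.

(** Insert [u_- u_+ = 1] on the left and [v_- v_+ = 1] on the right; the middle becomes
    [(u t)_+ (v s)_- = p_(u t)]. *)
Lemma fsmr_pm u v s t : (u * t = v * s)%g ->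
  p t * m s = m u * phi (al (u * t)%g 1) * p v.
Proof.
move=> uv; have -> : p t * m s = m u * (p u * p t) * (m s * m v) * p v.
  rewrite -!mulrA (skew_mp rel) mulr1 mulrA (skew_mp rel).
  by rewrite mul1r.
rewrite -(skew_pM rel) -(skew_mM rel) -uv -(mulrA (m u)).
by rewrite (skew_pm rel).
Qed.

(** Puts the middle factor in the form [p_s a p_t] seen by the corner, using [s_- p_s = s_-] and
    [p_t t_+ = t_+]. *)
Lemma component_corner s a t :
  m s * phi a * p t = m s * phi (al s 1 * a * al t 1) * p t.
Proof.
have ms : m s * phi (al s 1) = m s.
  by rewrite -(skew_Am rel) rmorph1 mul1r.
have pt : phi (al t 1) * p t = p t.
  by rewrite -(skew_pA rel) rmorph1 mulr1.
by rewrite !rmorphM !mulrA ms -(mulrA _ (phi (al t 1))) pt.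
Qed.

Fact component0 g : comp g 0.
Proof.
have [s [t gE]] := lfg_frac iotaP g.
by exists s, t, 0; rewrite rmorph0 mulr0 mul0r gE.
Qed.

Fact componentB g x y : comp g x -> comp g y -> comp g (x - y).
Proof.
move=> [s [t [a [gE ->]]]] [s' [t' [a' [gE' ->]]]].
have [u [v uv]] := left_oreP s s'.
(* Equalising the left denominators equalises the right ones too, as [t = s g] and [t' = s' g] in
   [G]. *)
have uv' : (u * t' = v * t)%g.
  apply: (lfg_inj iotaP); rewrite !(lfgM iotaP).
  have -> : iota t = (iota s * g)%g by rewrite -gE mulgA mulgV mul1g.
  have -> : iota t' = (iota s' * g)%g by rewrite -gE' mulgA mulgV mul1g.
  by rewrite !mulgA -!(lfgM iotaP) uv.
exists (v * s)%g, (v * t)%g, (al v a - al u a'); split.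
  by rewrite !(lfgM iotaP) invgM -!mulgA mulKg.
rewrite (fsmr_scale v s) (fsmr_scale u s') uv uv'.
by rewrite rmorphB mulrBr mulrBl.
Qed.

Fact componentM g h x y : comp g x -> comp h y -> comp (g * h)%g (x * y).
Proof.
move=> [s [t [a [<- ->]]]] [s' [t' [b [<- ->]]]].
have [u [v uv]] := left_oreP s' t.
exists (u * s)%g, (v * t')%g, (al u a * al (u * t)%g 1 * al v b); split.
  have /(congr1 iota) := uv; rewrite !(lfgM iotaP) invgM => uv'.
  have -> : iota v = (iota u * iota t * (iota s')^-1)%g by rewrite uv' mulgK.
  by rewrite -!mulgA mulKg.
rewrite !mulrA -(mulrA _ (p t)) (fsmr_pm uv) (skew_mM rel) (skew_pM rel).
rewrite !rmorphM !mulrA; congr (_ * _); rewrite -!mulrA; congr (_ * _).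
by rewrite (skew_pA rel) !mulrA (skew_Am rel).
Qed.

(** Vanishing off [X] allows two decompositions to be summed over the union of their supports. *)
Definition graded_sum (r : R) : Prop := exists (F : G -> R) (X : {fset G}),
  [/\ forall g, comp g (F g), forall g, g \notin X -> F g = 0 &
      r = \sum_(g <- X) F g].

Lemma graded_sumB x y : graded_sum x -> graded_sum y -> graded_sum (x - y).
Proof.
move=> [F [X [Fc FX ->]]] [F' [X' [F'c F'X ->]]].
exists (fun g => F g - F' g), (X `|` X')%fset; split=> [g|g|].
- exact: componentB.
- by rewrite inE negb_or => /andP[/FX -> /F'X ->]; rewrite subrr.
rewrite big_split sumrN /=; congr (_ - _).
  by apply: big_fset_incl; rewrite ?fsubsetUl // => g _ /FX.
by apply: big_fset_incl; rewrite ?fsubsetUr // => g _ /F'X.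
Qed.

Lemma graded_sum_component g x : comp g x -> graded_sum x.
Proof.
move=> gx; exists (fun h => if h == g then x else 0), [fset g]%fset.
split=> [h|h|]; last by rewrite big_seq_fset1 eqxx.
  by case: eqP => [->|_] //; apply: component0.
by rewrite inE => /negPf ->.
Qed.

(** Sums of homogeneous elements form a subring, and the generators are homogeneous. *)
Lemma graded_sumP (r : R) : graded_sum r.
Proof.
have G0 : graded_sum 0 by apply: graded_sum_component (component0 1%g).
have GD x y : graded_sum x -> graded_sum y -> graded_sum (x + y).
  by move=> gx gy; rewrite -[y]opprK; apply: graded_sumB => //;
    rewrite -sub0r; apply: graded_sumB.
apply/(@asboolP (graded_sum r)).
have PP : subring_closed (fun x => `[< graded_sum x >]).
  split=> [|x y|x y]; first last.
  - move=> /asboolP[F [X [Fc _ ->]]] /asboolP[F' [X' [F'c _ ->]]]; apply/asboolP.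
    rewrite mulr_suml; apply: big_ind => // g _.
    rewrite mulr_sumr; apply: big_ind => // h _.
    exact: graded_sum_component (componentM (Fc g) (F'c h)).
  - by move=> /asboolP gx /asboolP gy; apply/asboolP/graded_sumB.
  apply/asboolP/(@graded_sum_component 1%g); exists 1%g, 1%g, 1.
  by rewrite mulVg rmorph1 (skew_m1 rel) (skew_p1 rel) !mulr1.
apply: (fsmr_subring_ind PP) => x; apply/asboolP.
- apply/(@graded_sum_component 1%g); exists 1%g, 1%g, x.
  by rewrite mulVg (skew_m1 rel) (skew_p1 rel) mul1r mulr1.
- apply/(@graded_sum_component (iota x)^-1%g); exists x, 1%g, 1.
  by rewrite (lfg1 iotaP) mulg1 rmorph1 (skew_p1 rel) !mulr1.
apply/(@graded_sum_component (iota x)); exists 1%g, x, 1.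
by rewrite (lfg1 iotaP) invg1 mul1g rmorph1 (skew_m1 rel) !mul1r.
Qed.

End Grading.

(** * Criterion for the map to the corner to be a graded isomorphism *)

Section CornerIso.
Variables (S : cancelLeftOreType) (G : groupType) (iota : S -> G).
Hypothesis iotaP : left_fraction_group iota.
Variables (A B : pzRingType) (al : endr_action S A) (be : endr_action S B).
Variable f : {rmorphism A -> B}.
Hypothesis f_act : forall s a, f (al s a) = be s (f a).
Hypothesis be_inj : forall s, injective (be s).
(** [f_ker] and [f_cofinal] say that [f] is injective and surjective up to the action; they yield
    injectivity and surjectivity of [Phi] respectively. *)
Hypothesis f_ker : forall a, f a = 0 -> exists s, al s a = 0.
Hypothesis f_cofinal : forall b, exists s a, be s b = f a.
Variable R : fracSkewMonoidRing al.

Local Notation ah := (frac_aut iotaP be).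
Local Notation e := (loc_idem be).
Local Notation CG := (skew_group_ring ah).
Local Notation eCGe := (corner (sgr_incl_idem ah (@loc_idemP S B be))).
Local Notation phi := (fsmr_phi R).
Local Notation m := (fsmr_m R).
Local Notation p := (fsmr_p R).
Local Notation comp := (@fsmr_component S A al R G iota).

Lemma frac_eq0 s b : frac be s b = 0 -> b = 0.
Proof.
rewrite -[0]/(frac be 1%g 0) => /fracP[u [v [_]]].
by move=> bu; apply: (be_inj (s := u)); rewrite bu !endr_act0.
Qed.

Variable Phi : {rmorphism R -> eCGe}.
Hypothesis PhiE : forall s a t, val (Phi (m s * phi a * p t)) =
  << frac be s (be s 1 * f a * be t 1) *g ((iota s)^-1 * iota t)%g >>.

Lemma Phi_component g x : comp g x -> corner_component g (Phi x).
Proof. by move=> [s [t [a [<- ->]]]]; rewrite /corner_component PhiE; eexists. Qed.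

Lemma Phi_component_eq0 g x : comp g x -> (val (Phi x))@_g = 0 -> x = 0.
Proof.
move=> [s [t [a [<- ->]]]]; rewrite PhiE mcoeffUU => /frac_eq0.
(* The numerator is [f (p_s a p_t)], so some [u] kills [p_s a p_t]. *)
rewrite -[1]/(1 : B) -(rmorph1 f) -!f_act -!rmorphM => /f_ker[u ua].
rewrite component_corner (fsmr_scale R u) ua rmorph0 mulr0 mul0r //.
Qed.

(** As [Phi] is graded, the coefficient at [g] sees only the component [F g] of [x], which reduces
    the claim to homogeneous elements. *)
Lemma Phi_eq0 x : Phi x = 0 -> x = 0.
Proof.
have [F [X [Fc FX ->]]] := graded_sumP iotaP x => Phi0.
apply: big1_seq => g /andP[_ gX]; apply: (Phi_component_eq0 (Fc g)).
have : (val (Phi (\sum_(h <- X) F h)))@_g = 0 by rewrite Phi0; apply: mcoeff0.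
rewrite rmorph_sum !raddf_sum (big_fsetD1 g) //=.
rewrite big1_seq ?addr0 // => h /andP[_]; rewrite !inE => /andP[hg _].
have [c ->] := Phi_component (Fc h).
by rewrite mcoeffU (negPf hg).
Qed.

Lemma corner_homog_surj g c : exists2 x, comp g x &
  val (Phi x) = << e ** c ** ah g e *g g >>.
Proof.
have [s0 [b ->]] := locW c; have [k [a kb]] := f_cofinal b.
have [s1 [t1 gE]] := lfg_frac iotaP g.
(* With [l k s0 = l' s1], the class [[s0, b]] becomes [[l' s1, f (alpha_l(a))]], over a denominator
   that also presents [g] as [(l' s1)^-1 (l' t1)]. *)
have [l [l' lE]] := left_oreP s1 (k * s0)%g.
exists (m (l' * s1)%g * phi (al l a) * p (l' * t1)%g).
  exists (l' * s1)%g, (l' * t1)%g, (al l a); split=> //.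
  by rewrite !(lfgM iotaP) invgM -!mulgA mulKg.
rewrite PhiE; have <- : g = ((iota (l' * s1))^-1 * iota (l' * t1))%g.
  by rewrite !(lfgM iotaP) invgM -!mulgA mulKg.
congr << _ *g _ >>; rewrite (frac_scale be (l * k)%g s0) -mulgA lE.
rewrite (endr_act_mul be l k) kb -f_act loc_idem_mull.
rewrite -(loc_idem_mulr iotaP be _ (l' * t1)%g).
congr (_ ** ah _ _).
by rewrite gE !(lfgM iotaP) invgM -!mulgA mulKg.
Qed.

Lemma Phi_surj y : exists x, Phi x = y.
Proof.
suff [x xE] : exists x, val (Phi x) = val y by exists x; apply: val_inj.
have /in_cornerP[z ->] := valP y.
elim/sgr_ind: z => [|z z' [x xE] [x' xE']|c g].
- by exists 0; rewrite rmorph0 raddf0 numul0 nu0mul.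
- by exists (x + x'); rewrite rmorphD raddfD /= xE xE' numulDr numulDl.
have [x _ xE] := corner_homog_surj g c; exists x.
by rewrite xE !skewU_mul mul1g mulg1 aut_act1.
Qed.

Lemma Phi_inj : injective Phi.
Proof.
move=> x y xy; apply/eqP; rewrite -subr_eq0; apply/eqP/Phi_eq0.
by rewrite rmorphB xy subrr.
Qed.

Lemma Phi_bij : bijective Phi.
Proof.
pose h y := sval (cid (Phi_surj y)).
have hK : cancel h Phi by move=> y; rewrite /h; case: cid.
by exists h => // x; apply: Phi_inj; rewrite hK.
Qed.

Lemma Phi_componentP g x : comp g x <-> corner_component g (Phi x).
Proof.
split=> [|[c xE]]; first exact: Phi_component.
have [x' x'g x'E] := corner_homog_surj g c.
suff -> : x = x' by [].
apply/Phi_inj/val_inj; rewrite x'E.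
(* The unit of the corner fixes [Phi x] on both sides, so [c g = e c (g e) g]. *)
have := mul1r (Phi x); rewrite -{1}(mulr1 (Phi x)) => /(congr1 val).
by rewrite !val_cornerM xE /= !skewU_mul mul1g mulg1 aut_act1 numulA.
Qed.

End CornerIso.

(** The universal map into the corner over [S^-1 A] sends [phi a] to [[1, a]], which vanishes only
    for [a = 0]. *)
Lemma fsmr_phi_inj (S : cancelLeftOreType) (G : groupType) (iota : S -> G)
    (iotaP : left_fraction_group iota) (A : pzRingType) (al : endr_action S A)
    (al_inj : forall s, injective (al s)) (R : fracSkewMonoidRing al) :
  injective (fsmr_phi R).
Proof.
have rel := @corner_relations _ _ _ iotaP _ _ al al idfun (fun _ _ => erefl).
have [F [Fphi _ _ _]] := fsmr_univ R rel.
move=> a b ab; apply/eqP; rewrite -subr_eq0; apply/eqP.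
have : val (corner_phi iotaP al idfun (a - b)) = 0.
  by rewrite -Fphi /= rmorphB ab subrr !raddf0.
by move=> /eqP; rewrite monalgU_eq0 => /eqP /(frac_eq0 al_inj).
Qed.

(** * Specialisation to [B = S_- (A/I) S_+] *)

Section SasMorphism.
Variables (S : cancelLeftOreType) (A : pzRingType) (al : endr_action S A).
Variable Q : fracSkewMonoidRing (quotI_act al).

Definition quotI_sas (a : A) : sas Q := sas_phi Q (quotI_pi al a).

Fact quotI_sas_zmod : zmod_morphism quotI_sas.
Proof. by move=> a b; apply: val_inj; rewrite /= !raddfB. Qed.

Fact quotI_sas_monoid : monoid_morphism quotI_sas.
Proof.
by split=> [|a b]; apply: val_inj; rewrite /= ?rmorph1 ?rmorphM.
Qed.

HB.instance Definition _ :=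
  GRing.isZmodMorphism.Build A (sas Q) quotI_sas quotI_sas_zmod.
HB.instance Definition _ :=
  GRing.isMonoidMorphism.Build A (sas Q) quotI_sas quotI_sas_monoid.

(** In [S_- (A/I) S_+], [s_+ a s_- = alpha_s(a) p_s = alpha_s(a)]. *)
Lemma quotI_sas_act s a : quotI_sas (al s a) = sas_act Q s (quotI_sas a).
Proof.
apply: val_inj => /=; rewrite (skew_pA (fsmr_rel Q)) -mulrA.
rewrite (skew_pm (fsmr_rel Q)) -rmorphM -endr_actM mulr1.
by congr (fsmr_phi Q _); rewrite -quotI_act_pi.
Qed.

(** For [b = s_- a s_+], acting by [s] gives [p_s a p_s], an element of [A/I]. *)
Lemma quotI_sas_cofinal b : exists s a, sas_act Q s b = quotI_sas a.
Proof.
have /in_sasP[s [a' bE]] := valP b.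
exists s; elim/quotW: a' bE => a; rewrite -/(quotI_pi al a) => bE.
exists (al s 1 * a * al s 1); apply: val_inj => /=; rewrite bE.
rewrite !mulrA -(mulrA _ (fsmr_p Q s)) !(skew_pm (fsmr_rel Q)).
by rewrite !rmorphM /= -quotI_act_pi.
Qed.

End SasMorphism.

Theorem theorem3p9 (A : pzRingType) (S : cancelLeftOreType)
    (G : groupType) (iota : S -> G) (iotaP : left_fraction_group iota)
    (alpha : endr_action S A)
    (R : fracSkewMonoidRing alpha)
    (Q : fracSkewMonoidRing (quotI_act alpha)) :
  exists alphahat : aut_action G (loc_sas Q),
    (forall (s : S) (a : A),
       alphahat (iota s) (loc_sas_of Q a) = loc_sas_of Q (alpha s a)) /\
    exists (e : loc_sas Q) (ee : is_idempotent e),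
      [/\ (1 \notin ker_union alpha -> e != 0),
          (forall s : S, idempotent_le (alphahat (iota s) e) e) &
          exists Phi : {rmorphism R -> corner (sgr_incl_idem alphahat ee)},
            bijective Phi /\
            (forall (g : G) (r : R),
               fsmr_component iota g r <-> corner_component g (Phi r))].
Proof.
have phiQ_inj := fsmr_phi_inj iotaP (@quotI_act_inj S A alpha) (R := Q).
(* Since [A/I] embeds, the kernel of [A -> S_- (A/I) S_+] lies in [I]. *)
have f_ker a : quotI_sas Q a = 0 -> exists s, alpha s a = 0.
  move=> /(congr1 val) /=; rewrite -(rmorph0 (fsmr_phi Q)) => /phiQ_inj /eqP.
  by rewrite -(rmorph0 (quotI_pi alpha)) quotI_eq subr0 => /ker_unionP.
exists (frac_aut iotaP (sas_act Q)); split=> [s a|].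
  by rewrite [LHS]frac_aut1 -quotI_sas_act.
exists (loc_idem (sas_act Q)), (loc_idemP _); split=> [|s|].
(* If [e = [1, 1]] vanishes, then [1 = 0] in [S_- (A/I) S_+], so [1] lies in [I]. *)
- apply: contraNneq => /(frac_eq0 (@sas_act_inj _ _ _ Q)).
  by rewrite -(rmorph1 (quotI_sas Q)) => /f_ker /ker_unionP.
- rewrite /idempotent_le frac_aut1 loc_idem_mull endr_act1 mul1r.
  by rewrite /loc_idem loc_mulE mulr1.
have rel := corner_relations iotaP (@quotI_sas_act S A alpha Q).
have [Phi [Phi_phi Phi_m Phi_p _]] := fsmr_univ R rel.
have PhiE s a t : val (Phi (fsmr_m R s * fsmr_phi R a * fsmr_p R t)) =
    val (corner_m iotaP (sas_act Q) s *
         corner_phi iotaP (sas_act Q) (quotI_sas Q) a *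
         corner_p iotaP (sas_act Q) t).
  congr val; rewrite !rmorphM; congr (_ * _ * _).
  - exact: Phi_m.
  - exact: Phi_phi.
  - exact: Phi_p.
have {}PhiE s a t := etrans (PhiE s a t) (val_corner_homog iotaP _ _ s a t).
have sQ_act := @quotI_sas_act S A alpha Q.
have sQ_inj := @sas_act_inj S _ _ Q.
have sQ_cof := @quotI_sas_cofinal S A alpha Q.
exists Phi; split.
  exact: (Phi_bij sQ_act sQ_inj f_ker sQ_cof PhiE).
exact: (Phi_componentP sQ_act sQ_inj f_ker sQ_cof PhiE).
Qed.
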